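(* The set of accumulation points of Chern slopes of line arrangements over $\mathbb{R}$ is the interval $\left[2,\frac{5}{2}\right]$.
   Context: For a field $k$, a line arrangement over $k$ is a finite collection of two or more (distinct) lines in the projective plane $\mathbb{P}^2_k$, a line being a set $\{[x,y,z]\in\mathbb{P}^2_k : ax+by+cz=0\}$ with $a,b,c\in k$ not all zero. For an arrangement $\mathcal{A}$ of $d$ lines and $m\ge 2$, $t_m$ denotes the number of points lying on exactly $m$ lines of $\mathcal{A}$. The Chern numbers of $\mathcal{A}$ are $$\bar{c}_1^2(\mathcal{A})= 9-5d+\sum_{m \geq 2} (3m-4) t_m, \qquad \bar{c}_2(\mathcal{A})= 3-2d + \sum_{m \geq 2} (m-1) t_m.$$ Standing assumption: all arrangements of $d$ lines considered satisfy $t_d=t_{d-1}=0$ (for such arrangements $\bar{c}_2>0$). The Chern slope of such an arrangement is $\bar{c}_1^2(\mathcal{A})/\bar{c}_2(\mathcal{A})$. An accumulation point of Chern slopes over $k$ is an accumulation point in $\mathbb{R}$ of the set of all Chern slopes of line arrangements over $k$ with $t_d=t_{d-1}=0$. *)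

(* Defs.v *)
From HB Require Import structures.
From mathcomp Require Import all_boot all_order all_algebra finmap.
From mathcomp Require Import all_classical all_reals all_analysis.

Set Implicit Arguments.
Unset Strict Implicit.
Unset Printing Implicit Defensive.

Import Order.TTheory GRing.Theory Num.Theory.
Import numFieldNormedType.Exports.

Local Open Scope classical_set_scope.
Local Open Scope ring_scope.

(* A point of P^2_k is a line through the origin of k^3; [x, y, z] is the
   subspace spanned by the nonzero row vector (x, y, z). *)
Definition proj_plane (k : fieldType) : Type :=
  {P : {vspace 'rV[k]_3} | \dim P == 1%N}.

Definition line_of (k : fieldType) (a : 'rV[k]_3) : set (proj_plane k) :=
  [set P : proj_plane k | forall v : 'rV[k]_3,
     v \in (val P : {vspace 'rV[k]_3}) -> \sum_(i < 3) a 0 i * v 0 i = 0].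

Definition is_line (k : fieldType) (L : set (proj_plane k)) : Prop :=
  exists2 a : 'rV[k]_3, a != 0 & L = line_of a.

Definition line_arrangement (k : fieldType) (A : {fset set (proj_plane k)}) :
    Prop :=
  (2 <= #|` A|)%N /\ forall L, L \in A -> is_line L.

Definition mult_at (k : fieldType) (A : {fset set (proj_plane k)})
    (P : proj_plane k) : nat :=
  #|` [fset L in A | `[< L P >]]%fset|.

(* [fset_set] sends infinite sets to the empty one; this is harmless here, as
   for m >= 2 an arrangement has finitely many points of multiplicity m. *)
Definition t_ (k : fieldType) (A : {fset set (proj_plane k)}) (m : nat) : nat :=
  #|` fset_set [set P : proj_plane k | mult_at A P = m]|.

(* No point lies on more than d lines, so the sums over m >= 2 stop at d. *)
Definition chern1sq (k : fieldType) (A : {fset set (proj_plane k)}) : int :=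
  9 - 5 * (#|` A|)%:Z
  + \sum_(2 <= m < #|` A|.+1) (3 * m%:Z - 4) * (t_ A m)%:Z.

Definition chern2 (k : fieldType) (A : {fset set (proj_plane k)}) : int :=
  3 - 2 * (#|` A|)%:Z
  + \sum_(2 <= m < #|` A|.+1) (m%:Z - 1) * (t_ A m)%:Z.

Definition chern_slope (R : realType) (k : fieldType)
    (A : {fset set (proj_plane k)}) : R :=
  (chern1sq A)%:~R / (chern2 A)%:~R.

Definition chern_slopes (R : realType) (k : fieldType) : set R :=
  [set x | exists A : {fset set (proj_plane k)},
     [/\ line_arrangement A, t_ A #|` A| = 0%N, t_ A #|` A|.-1 = 0%N
       & x = chern_slope R A]].

Arguments chern_slopes R k _ : clear implicits.

(* Main.v *)
Require Import Defs.
From HB Require Import structures.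
From mathcomp Require Import all_boot all_order all_algebra.
From mathcomp Require Import zify ring lra.

Set Implicit Arguments.
Unset Strict Implicit.
Unset Printing Implicit Defensive.

(** For an arrangement of d lines with v vertices, put K := sum over the
    vertices of (multiplicity - 1).  Then c_2 = 3 - 2d + K and
    c_1^2 = 9 - 5d + 3K - v, and c_2 >= d - 4.  Boundedly many lines give only
    finitely many slopes, so a limit point is approached with d arbitrarily large.

    Lower bound: if r is the largest multiplicity, then 2c_2 - c_1^2 <= d - r - 1,
    while c_2 >= (r-2)(d-r-1) and r K >= d(d-1); hence 2 - c_1^2/c_2 is small as
    soon as d is large.

    Upper bound: over an ordered field K <= 2v (Melchior's inequality up to an
    additive constant), that is 2c_1^2 <= 5c_2 + 3.  In affine coordinates
    y = s x + b, a vertex of multiplicity m opens m - 1 cells to its right, and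
    the next vertex met (cyclically) on the boundary of such a cell has the cell
    just above or just below it; a vertex is reached at most twice in this way.

    Density: take the n axes of symmetry of a regular n-gon inscribed in a circle
    and s of the n tangents at its vertices.  Any two of these tangents meet on an
    axis and no three are concurrent, so the slope is 2 + (s-2)/(2(n-2)); every
    rational number in [2, 5/2] is of this form. *)

(** * Incidence counting *)

Section Incidence.
Variables (I : finType) (T : choiceType) (inc : I -> T -> bool) (pt : I -> I -> T).
Hypothesis ptP : forall i j p, i != j -> inc i p && inc j p = (p == pt i j).

Definition mult p := #|[set i | inc i p]|.

Definition verts : seq T :=
  undup [seq pt ij.1 ij.2 | ij <- enum {: I * I} & ij.1 != ij.2].

Definition excess := (\sum_(p <- verts) (mult p).-1)%N.

Lemma inc_pt i j : i != j -> inc i (pt i j) /\ inc j (pt i j).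
Proof. by move=> nij; apply/andP; rewrite ptP. Qed.

Lemma mem_verts p : (p \in verts) = (1 < mult p)%N.
Proof.
rewrite mem_undup; apply/mapP/card_gt1P => [[[i j]]|[i [j []]]].
  rewrite mem_filter /= => /andP[nij _] ->.
  by have [hi hj] := inc_pt nij; exists i, j; rewrite !inE.
rewrite !inE => hi hj nij; exists (i, j); first by rewrite mem_filter mem_enum nij.
by apply/eqP; rewrite -(ptP _ nij) hi.
Qed.

Lemma pt_verts i j : i != j -> pt i j \in verts.
Proof.
move=> nij; rewrite mem_verts; apply/card_gt1P; exists i, j; rewrite !inE.
by have [] := inc_pt nij.
Qed.

(** Double counting: two distinct lines share exactly one vertex, so each pair is counted once. This
    is applied below to all pairs, to pairs with one line in a pencil, and to pairs off the
    pencil. *)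
Lemma sum_pairs_verts (S : {set I * I}) : (forall ij, ij \in S -> ij.1 != ij.2) ->
  (\sum_(p <- verts) #|[set ij in S | inc ij.1 p && inc ij.2 p]| = #|S|)%N.
Proof.
move=> hS.
rewrite (eq_bigr (fun p => \sum_(ij in S) (inc ij.1 p && inc ij.2 p))%N); last first.
  move=> p _; rewrite -sum1_card (eq_bigl (fun ij => (ij \in S) && (inc ij.1 p && inc ij.2 p))) ?big_mkcondr /=.
    by apply: eq_bigr => ij _; case: (_ && _).
  by move=> ij; rewrite inE.
rewrite exchange_big /= -sum1_card; apply: eq_bigr => ij /hS nij.
rewrite (eq_bigr (fun p => if p == pt ij.1 ij.2 then 1 else 0)%N); last first.
  by move=> p _; rewrite ptP //; case: eqP.
by rewrite -big_mkcond sum1_count /= count_uniq_mem ?undup_uniq // pt_verts.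
Qed.

Lemma card_off_diag (A : {set I}) :
  #|[set ij : I * I | [&& ij.1 != ij.2, ij.1 \in A & ij.2 \in A]]| = (#|A| * #|A|.-1)%N.
Proof.
have -> : [set ij : I * I | [&& ij.1 != ij.2, ij.1 \in A & ij.2 \in A]]
   = setX A A :\: [set (i, i) | i in A].
  apply/setP => -[i j]; rewrite !inE /=; case: (boolP (i \in A)) => hi /=; last first.
    by rewrite !andbF.
  congr (_ && _); apply/idP/idP => [nij|]; last first.
    by apply: contra => /eqP ij; apply/imsetP; exists i; rewrite // -ij.
  by apply: contra nij => /imsetP[k _ [-> ->]].
rewrite cardsD cardsX (setIidPr _) ?card_imset; last 2 first.
- by move=> i j [].
- by apply/subsetP => _ /imsetP[i hi ->]; rewrite !inE hi.
by rewrite -[X in (_ - X)%N]muln1 -mulnBr subn1.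
Qed.

Lemma sum_mult_pred : (\sum_(p <- verts) mult p * (mult p).-1 = #|I| * #|I|.-1)%N.
Proof.
rewrite -cardsT -card_off_diag -(@sum_pairs_verts [set ij | [&& ij.1 != ij.2, ij.1 \in [set: I] & ij.2 \in [set: I]]]).
  apply: eq_bigr => p _; rewrite /mult -card_off_diag; apply: eq_card => ij.
  by rewrite !inE !andbT.
by move=> ij; rewrite !inE !andbT.
Qed.

Lemma excess_le : (excess <= #|I| * #|I|.-1)%N.
Proof.
rewrite -sum_mult_pred /excess !big_seq; apply: leq_sum => p.
by rewrite mem_verts => h; rewrite leq_pmull // ltnW.
Qed.

Lemma excess_ge_max r : (forall p, p \in verts -> mult p <= r)%N ->
  (#|I| * #|I|.-1 <= r * excess)%N.
Proof.
move=> hr; rewrite -sum_mult_pred /excess big_distrr /= !big_seq.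
by apply: leq_sum => p /hr h; rewrite leq_mul2r h orbT.
Qed.

(** Each vertex contributes at least 1 to the excess, and [p0] contributes [mult p0 - 2] more. *)
Lemma size_verts_le p0 : p0 \in verts -> (size verts + (mult p0 - 2) <= excess)%N.
Proof.
move=> h0; rewrite /excess -sum1_size (bigD1_seq p0) ?undup_uniq //=.
rewrite [X in (_ <= X)%N](bigD1_seq p0) ?undup_uniq //=.
have := h0; rewrite mem_verts => h.
rewrite addnAC; apply: leq_add; first lia.
rewrite big_seq_cond [X in (_ <= X)%N]big_seq_cond; apply: leq_sum => p /andP[+ _].
by rewrite mem_verts; lia.
Qed.

(** * The lines through one vertex against the lines that miss it *)

Section Pencil.
Variable p0 : T.
Hypothesis p0V : p0 \in verts.
Let r := mult p0.
Let s := #|[set i | ~~ inc i p0]|.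
Let E q := #|[set i | inc i p0 && inc i q]|.
Let B q := #|[set i | ~~ inc i p0 && inc i q]|.

Lemma pencil_card : (r + s)%N = #|I|.
Proof.
rewrite /r /mult /s -(cardsC [set i | inc i p0]); congr addn.
by apply: eq_card => i; rewrite !inE.
Qed.

Lemma mult_pencil q : mult q = (E q + B q)%N.
Proof.
rewrite /mult -(cardsID [set i | inc i p0]); congr addn; apply: eq_card => i;
  by rewrite !inE andbC.
Qed.

Lemma pencil_le1 q : q != p0 -> (E q <= 1)%N.
Proof.
apply: contraR; rewrite -ltnNge => /card_gt1P[i [j []]]; rewrite !inE.
move=> /andP[i0 iq] /andP[j0 jq] nij.
have := ptP q nij; have := ptP p0 nij; rewrite i0 j0 iq jq /=.
by move=> /esym/eqP-> /esym/eqP->.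
Qed.

Lemma sum_pencil : (\sum_(q <- verts) E q * B q = r * s)%N.
Proof.
rewrite -cardsX -(@sum_pairs_verts (setX _ _)).
  apply: eq_bigr => q _; rewrite -cardsX; apply: eq_card => -[i j]; rewrite !inE /=.
  by rewrite !andbA (andbAC (inc i p0)).
by case=> i j; rewrite !inE /=; case: eqP => [->|//]; case: (inc j p0).
Qed.

Lemma pencil_center : B p0 = 0%N.
Proof. by apply/eqP; rewrite cards_eq0; apply/eqP/setP => i; rewrite !inE andNb. Qed.

(** Away from [p0] at most one line of the pencil passes through [q], so [E q * B q] is at most
    [mult q - 1]; [p0] itself contributes [r - 1]. *)
Lemma excess_pencil : (r.-1 + r * s <= excess)%N.
Proof.
rewrite -sum_pencil /excess (bigD1_seq p0) ?undup_uniq //=.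
rewrite [X in (_ <= X)%N](bigD1_seq p0) ?undup_uniq //= pencil_center muln0 add0n.
rewrite leq_add2l; apply: leq_sum => q /pencil_le1; rewrite mult_pencil; nia.
Qed.

(** The incidence pattern of the axes and tangents that yield density; it turns the preceding bound
    into an equality. *)
Hypothesis all_on_pencil : forall q, q \in verts -> q != p0 -> E q = 1%N /\ (B q <= 2)%N.

Lemma excess_pencil_eq : excess = (r.-1 + r * s)%N.
Proof.
rewrite -sum_pencil /excess (bigD1_seq p0) ?undup_uniq //=.
rewrite [in RHS](bigD1_seq p0) ?undup_uniq //= pencil_center muln0 add0n; congr addn.
rewrite big_seq_cond [RHS]big_seq_cond; apply: eq_bigr => q /andP[qV q0].
by have [e1 _] := all_on_pencil qV q0; rewrite mult_pencil e1 add1n mul1n.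
Qed.

Lemma sum_off_pencil : (\sum_(q <- verts) B q * (B q).-1 = s * s.-1)%N.
Proof.
rewrite -card_off_diag -(@sum_pairs_verts [set ij | _]).
  apply: eq_bigr => q _; rewrite -card_off_diag; apply: eq_card => -[i j]; rewrite !inE /=.
  by case: (i == j); case: (inc i p0); case: (inc j p0); case: (inc i q); case: (inc j q).
by case=> i j; rewrite !inE /= => /andP[].
Qed.

(** Away from [p0] the multiplicity is [1 + B q] with [B q] equal to 1 or 2, and in both cases
    [2 B = 2 + B (B - 1)]. *)
Lemma size_verts_pencil : (2 * excess = 2 * size verts + 2 * (r - 2) + s * s.-1)%N.
Proof.
have r2 : (1 < r)%N by rewrite -mem_verts.
rewrite -sum_off_pencil /excess -sum1_size !big_distrr /=.
rewrite (bigD1_seq p0) ?undup_uniq //=.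
rewrite [X in (_ = X + _ + _)%N](bigD1_seq p0) ?undup_uniq //=.
rewrite [X in (_ = _ + X)%N](bigD1_seq p0) ?undup_uniq //= pencil_center mul0n add0n.
rewrite -(addnA _ _ (2 * (r - 2))) (addnC _ (2 * (r - 2))) addnA -addnA -big_split /= -/r.
have -> : (2 * r.-1 = 2 * 1 + 2 * (r - 2))%N by lia.
congr addn; rewrite big_seq_cond [RHS]big_seq_cond; apply: eq_bigr => q /andP[qV q0].
have [e1 b2] := all_on_pencil qV q0; rewrite mult_pencil e1.
move: qV; rewrite mem_verts mult_pencil e1 => b1.
by have [->|->] : B q = 1%N \/ B q = 2%N by lia.
Qed.

End Pencil.
End Incidence.

(** * Melchior's inequality *)

Import Order.TTheory GRing.Theory Num.Theory.
Local Open Scope ring_scope.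

(** An injection given only as a relation, so that no image has to be chosen. *)
Lemma leq_size_inj_rel (A B : eqType) (r : A -> B -> Prop) (s : seq A) (t : seq B) :
  uniq s -> (forall a, a \in s -> exists2 b, b \in t & r a b) ->
  (forall a a' b, r a b -> r a' b -> a = a') -> (size s <= size t)%N.
Proof.
move=> + + rI; elim: s t => [//|a s IH] t /= /andP[nas us] h.
have [b bt rab] := h a (mem_head _ _).
have t0 : (0 < size t)%N by case: t bt {h}.
rewrite -(prednK t0) ltnS -(size_rem bt); apply: IH => // a' a's.
have [|b' b't ra'b'] := h a'; first by rewrite inE a's orbT.
exists b' => //; have [eb|nb] := eqVneq b' b; last first.
  by move: b't; rewrite (perm_mem (perm_to_rem bt)) inE (negbTE nb).
by move: nas; rewrite (rI _ _ _ rab (_ : r a' b)) ?a's // -eb.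
Qed.

Section Melchior.
Variables (R : realFieldType) (I : finType) (T : choiceType).
Variables (inc : I -> T -> bool) (pt : I -> I -> T).
Hypothesis ptP : forall i j p, i != j -> inc i p && inc j p = (p == pt i j).
Variables (s b : I -> R) (x y : T -> R).
Let f i p := s i * x p + b i.
Let V := verts pt.
(** No two lines meet at infinity; [melchior] chooses coordinates with this property. *)
Hypothesis s_inj : injective s.
Hypothesis inc_affine : forall i p, p \in V -> inc i p = (y p == f i p).
Hypothesis no_pencil : forall p, exists i, ~~ inc i p.

(* The lines are ordered along the vertical line just to the left of [w];
   [l] is the lowest line through [w] and [l'] the line just below it.  For
   [e = -1] the picture is reflected upside down. *)
Definition next_below (e : R) (w : T) (l l' : I) : Prop :=
  [/\ inc l w, forall k, inc k w -> e * s k <= e * s l, e * f l' w < e * f l w &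
      forall k, e * f k w < e * f l w ->
        e * f k w < e * f l' w \/ f k w = f l' w /\ e * s l' <= e * s k].

(** Both lines are extremal and lines of equal slope coincide, so a vertex and a side determine the
    pair. *)
Lemma next_below_uniq e w l1 l1' l2 l2' : e != 0 ->
  next_below e w l1 l1' -> next_below e w l2 l2' -> l1 = l2 /\ l1' = l2'.
Proof.
move=> e0 [i1 m1 b1 n1] [i2 m2 b2 n2].
have e12 : l1 = l2.
  by apply: s_inj; apply: (mulfI e0); apply/eqP; rewrite eq_le m1 // m2.
split=> //; subst l2.
have [h1|[g1 h1]] := n1 _ b2; have [h2|[g2 h2]] := n2 _ b1.
- by move: (lt_trans h1 h2); rewrite ltxx.
- by move: h1; rewrite g2 ltxx.
- by move: h2; rewrite g1 ltxx.
by apply: s_inj; apply: (mulfI e0); apply/eqP; rewrite eq_le h1 h2.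
Qed.

Section Side.
Variables (e : R) (v w : T) (l l' : I).
Hypotheses (e2 : e * e = 1) (vV : v \in V) (wV : w \in V).
Hypotheses (lv : inc l v) (l'v : inc l' v) (lw : inc l w).
Hypothesis above : e * f l' w < e * f l w.
Hypothesis adj : forall k, inc k v -> 0 <= (s k - s l) * (s k - s l').
(* The product is nonnegative when the crossing of [k] with [l] does not come
   strictly between [v] and [w] in the cyclic order starting at [v]. *)
Hypothesis first_l : forall k,
  0 <= (x w - x v) * ((f k v - f l v) * (f k w - f l w)).
Hypothesis first_l' : forall k,
  0 <= (x w - x v) * ((f k v - f l' v) * (f k w - f l' w)).

Let incf i p : p \in V -> inc i p -> f i p = y p.
Proof. by move=> pV; rewrite inc_affine // => /eqP. Qed.

(** A line violating the conclusion would cross [l] or [l'] strictly between [v] and [w], or pass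
    through [v] with a slope between theirs; the hypotheses exclude both. *)
Lemma next_belowI : next_below e w l l'.
Proof.
have ev : f l v = f l' v by rewrite !incf.
have dl : f l w - f l v = s l * (x w - x v) by rewrite /f; ring.
have dl' : f l' w - f l' v = s l' * (x w - x v) by rewrite /f; ring.
have dk k : f k w - f k v = s k * (x w - x v) by rewrite /f; ring.
have fl := first_l; have fl' := first_l'.
set c := x w - x v in dl dl' dk fl fl'.
have c2 : 0 < c ^+ 2.
  rewrite exprn_even_gt0 //=; apply: contraTneq above => c0.
  by rewrite (_ : f l' w = f l w) ?ltxx //; move: dl dl'; rewrite c0 ev; lra.
have e_prod a a' : a * a' = (e * a) * (e * a') by rewrite mulrACA e2 mul1r.
split=> // k.
  move=> kw; have ek : f k w = f l w by rewrite !incf.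
  rewrite leNgt; apply/negP => hs; have := fl' k; rewrite leNgt => /negP; apply.
  have -> : c * ((f k v - f l' v) * (f k w - f l' w)) =
            - (c ^+ 2 * ((e * (s k - s l)) * (e * (f l w - f l' w)))).
    rewrite -e_prod -ev ek.
    have -> : f k v - f l v = - ((s k - s l) * c) by move: (dk k) dl; rewrite ek; lra.
    ring.
  rewrite oppr_lt0; apply: mulr_gt0 => //.
  by apply: mulr_gt0; rewrite mulrBr subr_gt0.
move=> h; case: (ltgtP (e * f k w) (e * f l' w)) => h'; first by left.
  (* At the abscissa of [w], [k] runs strictly between [l'] and [l]. The product of [first_l] and
     [first_l'] is a square times a negative number, so [k] passes through [v], against [adj]. *)
  exfalso.
  have eu : e * (f k w - f l w) < 0 by lra.
  have eu' : 0 < e * (f k w - f l' w) by lra.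
  have uu : (f k w - f l w) * (f k w - f l' w) < 0 by rewrite e_prod nmulr_rlt0.
  have := fl k; have := fl' k; rewrite -ev !mulrA => h1 h2.
  have p0 : c * (f k v - f l v) = 0.
    have := mulr_ge0 h1 h2; set P := c * _; rewrite mulrACA (mulrC (_ - f l' w)).
    rewrite nmulr_lge0 // -expr2 => hP; apply/eqP; rewrite -sqrf_eq0.
    by rewrite eq_le hP sqr_ge0.
  have {}p0 : f k v = f l v.
    apply/eqP; rewrite -subr_eq0; move/eqP: p0; rewrite mulf_eq0 => /orP[/eqP c0|//].
    by move: c2; rewrite c0 expr0n ltxx.
  have kv : inc k v by rewrite inc_affine // p0 incf.
  have := adj kv; apply/negP; rewrite -ltNge.
  move: uu; have -> : (f k w - f l w) * (f k w - f l' w) = c ^+ 2 * ((s k - s l) * (s k - s l')).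
    have -> : f k w - f l w = (s k - s l) * c by move: (dk k) dl; lra.
    have -> : f k w - f l' w = (s k - s l') * c by move: (dk k) dl'; lra.
    ring.
  by rewrite pmulr_rlt0.
right; have {}h' : f k w = f l' w.
  by have := congr1 (fun z => e * z) h'; rewrite !mulrA e2 !mul1r.
split=> //; rewrite leNgt; apply/negP => hs.
have := fl k; rewrite leNgt => /negP; apply.
have -> : c * ((f k v - f l v) * (f k w - f l w)) =
          c ^+ 2 * ((e * (s l' - s k)) * (e * (f k w - f l w))).
  rewrite -e_prod; have -> : f k v - f l v = (s l' - s k) * c by move: (dk k) dl'; lra.
  ring.
rewrite pmulr_rlt0 // pmulr_rlt0; first by rewrite mulrBr subr_lt0.
by rewrite mulrBr subr_gt0.
Qed.
End Side.

(** [w] is the next vertex met on [l] or [l'] when leaving [v] to the right, possibly through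
    infinity. It exists because some line misses [v] and so meets [l] elsewhere. *)
Lemma exists_first v l l' : v \in V -> inc l v -> inc l' v ->
  exists w, [/\ w \in V, w != v, inc l w || inc l' w &
    forall k m, m \in [:: l; l'] ->
      0 <= (x w - x v) * ((f k v - f m v) * (f k w - f m w))].
Proof.
move=> vV lv l'v; pose L (c : bool) := if c then l else l'.
have Lv c : inc (L c) v by case: c.
have ninc k c : ~~ inc k v -> k != L c by apply: contraNneq => ->.
have xneq k c : ~~ inc k v -> x (pt k (L c)) - x v != 0.
  move=> kv; have nk := ninc k c kv; have qV := pt_verts ptP nk.
  have [kq Lq] := inc_pt ptP nk; rewrite subr_eq0; apply: contra kv => /eqP xq.
  move: kq Lq (Lv c); rewrite !inc_affine // /f xq => /eqP eq1 /eqP eq2 /eqP ->.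
  by rewrite -eq2 eq1.
have [k0 k0v] := no_pencil v.
(* Maximizing [1 / (x - x v)] picks the first vertex when one leaves [v] to the
   right, passes through infinity and comes back from the left. *)
pose F (kc : I * bool) := (x (pt kc.1 (L kc.2)) - x v)^-1.
case: (@arg_maxP _ R _ (k0, true) (fun kc => ~~ inc kc.1 v) F k0v) => -[k1 c1] /= k1v maxF.
have nk1 := ninc k1 c1 k1v; have wV := pt_verts ptP nk1; have [k1w Lw] := inc_pt ptP nk1.
have c0 := xneq k1 c1 k1v.
set w := pt k1 (L c1) in wV k1w Lw c0 *.
exists w; split => //.
- by apply: contraNneq k1v => <-.
- by move: Lw; rewrite {1}/L; case: ifP => _ ->; rewrite ?orbT.
move=> k m hm; have {hm m} [c ->] : exists c, m = L c.
  by move: hm; rewrite !inE => /orP[]/eqP->; [exists true|exists false].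
have [kv|kv] := boolP (inc k v).
  have -> : f k v = f (L c) v by move: kv (Lv c); rewrite !inc_affine // => /eqP<- /eqP<-.
  by rewrite subrr mul0r mulr0.
have := maxF (k, c) kv; rewrite /F /= -/w; have u0 := xneq k c kv.
have nk := ninc k c kv; have [] := inc_pt ptP nk; have qV := pt_verts ptP nk.
set q := pt k (L c) in u0 qV *; rewrite !inc_affine // => /eqP e1 /eqP e2.
have -> : f k v - f (L c) v = - ((s k - s (L c)) * (x q - x v)).
  by move: e2; rewrite e1 /f => e3; lra.
have -> : f k w - f (L c) w = (s k - s (L c)) * ((x w - x v) - (x q - x v)).
  by move: e2; rewrite e1 /f => e3; lra.
set d := x w - x v in c0 *; set u := x q - x v in u0 *; set S := s k - _ => h.
(* The product is a square times [d^-1 - u^-1], whose sign is given by the maximality of [F]. *)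
have -> : d * (- (S * u) * (S * (d - u))) = (S * d * u) ^+ 2 * (d^-1 - u^-1) by field; rewrite c0 u0.
by rewrite mulr_ge0 ?sqr_ge0 // subr_ge0.
Qed.

(** Such a line stands for the cell opening to the right of [p] just beneath it. *)
Let nonmin p := [set i | inc i p && [exists k, inc k p && (s k < s i)]].

Let card_nonmin p : p \in V -> #|nonmin p| = (mult inc p).-1.
Proof.
rewrite (mem_verts ptP) => hp.
have [i0 i0p] : exists i, inc i p.
  by have /card_gt0P[i] := ltnW hp; rewrite inE; exists i.
case: (@arg_minP _ R _ i0 (inc ^~ p) s i0p) => i1 i1p mini.
rewrite /mult (cardsD1 i1 [set i | inc i p]) inE i1p /= add0n; apply: eq_card => i; rewrite !inE andbC.
have [ip|] := boolP (inc i p); rewrite ?andbF ?andbT //=.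
apply/existsP/idP => [[k /andP[kp ki]]|ne].
  by apply: contraTneq ki => ->; rewrite -leNgt mini.
exists i1; rewrite i1p lt_neqAle mini // andbT.
by apply: contraNneq ne => /s_inj->.
Qed.

(** A flag [(v, i)] is the cell just beneath [i] to the right of [v]. It is related to the corner
    [(w, e)], with [w] the first vertex reached and [e] the side on which the other bounding line
    passes. A corner determines both lines, hence [v] as their intersection and [i] as the one of
    larger slope. *)
Lemma excess_le_melchior : (excess inc pt <= 2 * size V)%N.
Proof.
pose flags := [seq (p, i) | p <- V, i <- enum (nonmin p)].
pose corners := [seq (p, e) | p <- V, e <- [:: true; false]].
pose sgn (e : bool) : R := if e then 1 else -1.
have sgn2 e : sgn e * sgn e = 1 by case: e; rewrite /sgn; ring.
have sgn0 e : sgn e != 0 by case: e; rewrite /sgn ?oppr_eq0 oner_eq0.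
pose rel (a : T * I) (c : T * bool) := exists l l',
  [/\ next_below (sgn c.2) c.1 l l', inc l a.1, inc l' a.1 &
     s l' < s l /\ a.2 = l \/ s l < s l' /\ a.2 = l'].
have -> : excess inc pt = size flags.
  rewrite size_allpairs_dep /excess sumnE big_map !big_seq; apply: eq_bigr => p pV.
  by rewrite -cardE card_nonmin.
have -> : (2 * size V)%N = size corners by rewrite size_allpairs mulnC.
apply: (@leq_size_inj_rel _ _ rel).
- apply: allpairs_uniq_dep; first exact: undup_uniq.
    by move=> p _; exact: enum_uniq.
  by move=> t t' _ _; case: t t' => [p i] [p' i'] /= [e1 e2]; subst.
- move=> a /allpairsPdep[v [l [vV]]]; rewrite mem_enum inE => /andP[lv /existsP[k0 k0P] ->].
  (* [l'] is the line through [v] that comes just below [l] in slope. *)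
  case: (@arg_maxP _ R _ k0 (fun k => inc k v && (s k < s l)) s k0P) => l' /andP[l'v sl'] maxl'.
  have adj k : inc k v -> 0 <= (s k - s l) * (s k - s l').
    move=> kv; have [kl|kl] := ltP (s k) (s l).
      apply: mulr_le0; first by rewrite subr_le0 ltW.
      by rewrite subr_le0; apply: maxl'; rewrite kv.
    by rewrite mulr_ge0 // subr_ge0 // ltW // (lt_le_trans sl').
  have [w [wV wv llw first]] := exists_first vV lv l'v.
  have nll' : l != l' by apply: contraTneq sl' => ->; rewrite ltxx.
  (* [l] and [l'] meet only at [v], so [w] lies on exactly one of them. *)
  have nww : ~~ (inc l w && inc l' w).
    by apply: contra wv; rewrite ptP // => /eqP->; rewrite eq_sym -ptP // lv.
  have main m m' : inc m w -> ~~ inc m' w -> inc m v -> inc m' v ->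
      (forall k, inc k v -> 0 <= (s k - s m) * (s k - s m')) ->
      m \in [:: l; l'] -> m' \in [:: l; l'] ->
      exists2 e, (w, e) \in corners & next_below (sgn e) w m m'.
    move=> mw m'w mv m'v adjm ml m'l; exists (f m' w < f m w).
      by apply: allpairs_f; rewrite // !inE; case: (_ < _).
    apply: (@next_belowI _ v) => //; try (by move=> k; exact: first).
    move: mw m'w; rewrite !inc_affine // => /eqP-> nm'.
    by case: (ltgtP (f m' w) (f m w)) nm' => [h|h|->]; rewrite /sgn ?eqxx // ?mul1r // !mulN1r ltrN2.
  have lin : l \in [:: l; l'] by rewrite mem_head.
  have l'in : l' \in [:: l; l'] by rewrite !inE eqxx orbT.
  have [lw|lw] := boolP (inc l w).
    have l'w : ~~ inc l' w by move: nww; rewrite lw.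
    have [e eC nb] := main l l' lw l'w lv l'v adj lin l'in.
    by exists (w, e) => //; exists l, l'; split => //=; left.
  have l'w : inc l' w by move: llw; rewrite (negbTE lw).
  have adj' k : inc k v -> 0 <= (s k - s l') * (s k - s l) by move=> kv; rewrite mulrC adj.
  have [e eC nb] := main l' l l'w lw l'v lv adj' l'in lin.
  by exists (w, e) => //; exists l', l; split => //=; right.
- move=> [p i] [p' i'] [w e] [l1 [l1' [/= nb1 lp1 lp1' h1]]] [l2 [l2' [/= nb2 lp2 lp2' h2]]].
  case: (next_below_uniq (sgn0 e) nb1 nb2) => e1 e2; subst l2 l2'.
  have nl : l1 != l1' by case: h1 => -[+ _]; apply: contraTneq => ->; rewrite ltxx.
  have -> : p = p'.
    have := ptP p nl; have := ptP p' nl; rewrite lp1 lp1' lp2 lp2'.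
    by move=> /esym/eqP-> /esym/eqP->.
  case: h1 h2 => -[h1 ->] [[h2 ->]|[h2 ->]] //.
    by move: (lt_trans h1 h2); rewrite ltxx.
  by move: (lt_trans h1 h2); rewrite ltxx.
Qed.
End Melchior.

(* Imported only here: [all_classical] shadows the [finset] and [fintype] names used above. *)
From mathcomp Require Import finmap all_classical all_reals all_analysis.
Import Order.TTheory GRing.Theory Num.Theory.
Import numFieldNormedType.Exports.
Local Open Scope classical_set_scope.
Local Open Scope ring_scope.

(** * The projective plane in coordinates *)

Section Projective.
Variable k : fieldType.
Implicit Types (a b u v : 'rV[k]_3) (P : proj_plane k).

Definition crd v (i : nat) : k := v 0 (inord i).

Definition vec3 (x y z : k) : 'rV[k]_3 := \row_(i < 3) nth 0 [:: x; y; z] i.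

Definition cross a b := vec3
  (crd a 1 * crd b 2 - crd a 2 * crd b 1)
  (crd a 2 * crd b 0 - crd a 0 * crd b 2)
  (crd a 0 * crd b 1 - crd a 1 * crd b 0).

Definition dot a v := \sum_(i < 3) a 0 i * v 0 i.

Lemma crd_vec3 x y z :
  (crd (vec3 x y z) 0 = x) * (crd (vec3 x y z) 1 = y) * (crd (vec3 x y z) 2 = z).
Proof. by rewrite /crd !mxE !inordK. Qed.

Lemma dotE a v : dot a v = crd a 0 * crd v 0 + crd a 1 * crd v 1 + crd a 2 * crd v 2.
Proof.
rewrite /dot !big_ord_recl big_ord0 addr0 /crd addrA.
by congr (_ * _ + _ * _ + _ * _); congr (_ 0 _); apply: val_inj; rewrite /= inordK.
Qed.

Lemma crd_inj u v : crd u 0 = crd v 0 -> crd u 1 = crd v 1 -> crd u 2 = crd v 2 -> u = v.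
Proof.
move=> h0 h1 h2; apply/rowP => -[i hi]; rewrite (_ : Ordinal hi = inord i); last first.
  by apply: val_inj; rewrite /= inordK.
by case: i hi => [|[|[|]]].
Qed.

Lemma crdZ c v i : crd (c *: v) i = c * crd v i.
Proof. by rewrite /crd mxE. Qed.

Lemma crd0 i : crd 0 i = 0.
Proof. by rewrite /crd mxE. Qed.

Lemma crd_neq0 v : v != 0 -> exists2 i, (i < 3)%N & crd v i != 0.
Proof.
move=> v0; apply: contrapT => h; move/eqP: v0; apply; apply: crd_inj; rewrite crd0;
  apply/eqP; apply: contrapT => /negP hi; apply: h.
- by exists 0%N.
- by exists 1%N.
- by exists 2%N.
Qed.

Definition mkpt u (u0 : u != 0) : proj_plane k :=
  exist _ <[u]>%VS (introT eqP (etrans (dim_vline u) (congr1 nat_of_bool u0))).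

Lemma mkpt_surj P : exists u (u0 : u != 0), P = mkpt u0.
Proof.
case: P => U dU; have U0 : vpick U != 0.
  by rewrite vpick0; apply: contraTneq dU => ->; rewrite dimv0.
exists (vpick U), U0; apply: val_inj => /=; apply/esym/eqP.
by rewrite eqEdim -memvE memv_pick dim_vline U0 (eqP dU).
Qed.

Lemma line_ofE a u (u0 : u != 0) : line_of a (mkpt u0) <-> dot a u = 0.
Proof.
split=> [h|h v /= /vlineP[c ->]]; first exact: (h u (memv_line u)).
rewrite (_ : \sum_i _ = c * dot a u); first by rewrite h mulr0.
rewrite /dot mulr_sumr.
by apply: eq_bigr => i _; rewrite mxE mulrCA.
Qed.

Lemma mkpt_eq u v c (u0 : u != 0) (v0 : v != 0) : u = c *: v -> mkpt u0 = mkpt v0.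
Proof.
move=> uv; apply: val_inj => /=; apply/eqP.
by rewrite eqEdim !dim_vline u0 v0 andbT -memvE uv memvZ ?memv_line.
Qed.

Lemma dot_crossl a b : dot a (cross a b) = 0.
Proof. by rewrite dotE !crd_vec3; ring. Qed.

Lemma dot_crossr a b : dot b (cross a b) = 0.
Proof. by rewrite dotE !crd_vec3; ring. Qed.

(** The coordinates satisfy [a_i b_j = a_j b_i], hence [a_i (b . u) = b_i (a . u)], where [a_i] is
    nonzero. *)
Lemma line_cross0 a b : a != 0 -> cross a b = 0 -> line_of a `<=` line_of b.
Proof.
move=> /crd_neq0[i i3 ai] ab0 P; have [u [u0 ->]] := mkpt_surj P.
move=> /line_ofE au; apply/line_ofE; apply: (mulfI ai); rewrite mulr0.
rewrite -[RHS](mulr0 (crd b i)) -au !dotE.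
have := congr1 (crd ^~ 0%N) ab0; have := congr1 (crd ^~ 1%N) ab0.
have := congr1 (crd ^~ 2%N) ab0; rewrite !crd_vec3 !crd0.
move=> /eqP; rewrite subr_eq0 => /eqP h2.
move=> /eqP; rewrite subr_eq0 => /eqP h1.
move=> /eqP; rewrite subr_eq0 => /eqP h0.
have cr j : (j < 3)%N -> crd a i * crd b j = crd a j * crd b i.
  by case: i i3 {ai} => [|[|[|//]]] _; case: j => [|[|[|//]]].
by rewrite !mulrDr !mulrA !cr //; ring.
Qed.

(** By the triple product formula [u x (a x b) = (b . u) a - (a . u) b = 0], so [u] is proportional
    to [a x b]. *)
Lemma cross_uniq a b (ab0 : cross a b != 0) P :
  line_of a P -> line_of b P -> P = mkpt ab0.
Proof.
have [u [u0 ->]] := mkpt_surj P; move=> /line_ofE au /line_ofE bu.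
have [i i3 ni] := crd_neq0 ab0.
apply: (@mkpt_eq _ _ (crd u i / crd (cross a b) i)).
have key j : (j < 3)%N -> crd u j * crd (cross a b) i = crd u i * crd (cross a b) j.
  move=> j3; have comb c d : c * dot a u + d * dot b u = 0 by rewrite au bu !mulr0 addr0.
  (* One coordinate of the triple product: [l] is the index other than [i] and [j], and [e] is its
     sign. *)
  have conclude l (e : k) : crd u j * crd (cross a b) i
      + (e * crd b l * dot a u + - e * crd a l * dot b u) = crd u i * crd (cross a b) j ->
    crd u j * crd (cross a b) i = crd u i * crd (cross a b) j by rewrite comb addr0.
  move: i3 conclude {ni}; rewrite !dotE; case: i => [|[|[|//]]] _;
    case: j j3 => [|[|[|//]]] _; rewrite !crd_vec3 // => conclude.
  - by apply: (conclude 2%N (-1)); ring.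
  - by apply: (conclude 1%N 1); ring.
  - by apply: (conclude 2%N 1); ring.
  - by apply: (conclude 0%N (-1)); ring.
  - by apply: (conclude 1%N (-1)); ring.
  - by apply: (conclude 0%N 1); ring.
by apply: crd_inj; rewrite crdZ mulrAC -key // mulfK.
Qed.

End Projective.

(** * Chern numbers of an indexed arrangement *)

Section Arrangement.
Variables (k : fieldType) (I : finType) (ell : I -> set (proj_plane k)).
Hypothesis ell_line : forall i, is_line (ell i).
Hypothesis ell_inj : injective ell.
Let A : {fset set (proj_plane k)} := [fset ell i | i in I]%fset.

Definition on (i : I) (P : proj_plane k) : bool := `[< ell i P >].

Lemma vec3_100_neq0 : vec3 1 0 0 != 0 :> 'rV[k]_3.
Proof.
by apply/eqP => /(congr1 (fun v => crd v 0)) /eqP; rewrite crd_vec3 crd0 oner_eq0.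
Qed.

(** For [i != j] the set is a singleton, and [xget] returns the intersection; the default point
    makes the function total. *)
Definition meet_pt (i j : I) : proj_plane k :=
  xget (mkpt vec3_100_neq0) [set P | on i P /\ on j P].

Lemma onE (a : 'rV[k]_3) i u (u0 : u != 0) : ell i = line_of a ->
  on i (mkpt u0) = (dot a u == 0).
Proof.
move=> e; rewrite /on e; apply/asboolP/eqP => [/line_ofE//|h].
exact/line_ofE.
Qed.

Lemma cross_ell_neq0 i j a b : i != j -> a != 0 -> b != 0 ->
  ell i = line_of a -> ell j = line_of b -> cross a b != 0.
Proof.
move=> nij a0 b0 ea eb; apply: contraNneq nij => ab; apply/eqP/ell_inj; rewrite ea eb.
rewrite eqEsubset; split; first exact: line_cross0.
apply: line_cross0 => //; apply: crd_inj;
  [move: (congr1 (fun v => crd v 0) ab)|move: (congr1 (fun v => crd v 1) ab)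
  |move: (congr1 (fun v => crd v 2) ab)];
  by rewrite !crd_vec3 !crd0 => h; rewrite -[RHS]oppr0 -h; ring.
Qed.

Lemma meet_ptP i j P : i != j -> on i P && on j P = (P == meet_pt i j).
Proof.
move=> nij; have [a a0 ea] := ell_line i; have [b b0 eb] := ell_line j.
have ab0 := cross_ell_neq0 nij a0 b0 ea eb.
have uniq Q : on i Q && on j Q -> Q = mkpt ab0.
  by move=> /andP[/asboolP + /asboolP]; rewrite ea eb => h h'; exact: cross_uniq.
have onm : on i (mkpt ab0) && on j (mkpt ab0).
  by rewrite (onE _ ea) (onE _ eb) dot_crossl dot_crossr eqxx.
have -> : meet_pt i j = mkpt ab0.
  by apply: xget_unique => [|Q [h h']]; [exact/andP|apply: uniq; rewrite h].
by apply/idP/eqP => [/uniq|->].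
Qed.

Lemma card_arrangement : #|` A| = #|I|.
Proof. by rewrite card_imfset //= -cardE. Qed.

Lemma mult_atE P : mult_at A P = mult on P.
Proof.
rewrite /mult_at /mult cardsE (_ : [fset L in A | `[< L P >]]%fset = [fset ell i | i in [pred i | on i P]]%fset).
  by rewrite card_imfset //= -cardE.
apply/fsetP => L; rewrite !inE /=; apply/andP/imfsetP => [[/imfsetP[i _ ->] h]|[i]].
  by exists i; rewrite //= inE.
rewrite /= inE => h ->; split; last exact/asboolP.
  by rewrite -[_ \in _]/(ell i \in A); apply/imfsetP; exists i.
Qed.

(** A point of multiplicity at least 2 is a vertex, so the set is finite and [fset_set] is faithful
    on it. *)
Lemma t_E m : (1 < m)%N -> t_ A m = count (fun P => mult on P == m) (verts meet_pt).
Proof.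
move=> m1; rewrite -size_filter; set X := [seq P <- _ | _].
have uX : uniq X by rewrite filter_uniq // undup_uniq.
rewrite /t_ (_ : [set P | _] = [set` seq_fset tt X]); last first.
  have memX P : (P \in seq_fset tt X) = (mult_at A P == m).
    rewrite seq_fsetE mem_filter mult_atE (mem_verts meet_ptP).
    by case: eqP => // ->; rewrite m1.
  by apply/seteqP; split => P; [move=> /eqP; rewrite -memX|move=> h; apply/eqP; rewrite -memX].
by rewrite set_fsetK size_seq_fset undup_id.
Qed.

Lemma mult_le P : (mult on P <= #|I|)%N.
Proof. exact: max_card. Qed.

(** Regrouping by vertices: every vertex has a multiplicity between 2 and [d], so it occurs in
    exactly one term. *)
Lemma sum_t_E (f : nat -> int) :
  \sum_(2 <= m < #|` A|.+1) f m * (t_ A m)%:Z = \sum_(P <- verts meet_pt) f (mult on P).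
Proof.
rewrite card_arrangement.
transitivity (\sum_(2 <= m < #|I|.+1) \sum_(P <- verts meet_pt) f m * (mult on P == m)%:Z).
  rewrite !big_nat; apply: eq_bigr => m /andP[m2 _]; rewrite t_E // -mulr_sumr.
  by rewrite -sum1_count (big_morph Posz PoszD erefl) big_mkcond /=; congr (_ * _); apply: eq_bigr => P _; case: eqP.
rewrite exchange_big !big_seq /=; apply: eq_bigr => P; rewrite (mem_verts meet_ptP) => P2.
rewrite (bigD1_seq (mult on P)) ?iota_uniq //=; last by rewrite mem_index_iota P2 ltnS mult_le.
rewrite eqxx mulr1 big1 ?addr0 // => m; rewrite eq_sym => /negbTE->; exact: mulr0.
Qed.

Lemma sum_mult_sub1 : \sum_(P <- verts meet_pt) ((mult on P)%:Z - 1) = (excess on meet_pt)%:Z.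
Proof.
rewrite /excess (big_morph Posz PoszD erefl) !big_seq; apply: eq_bigr => P; rewrite (mem_verts meet_ptP); lia.
Qed.

Lemma chern2E : chern2 A = 3 - 2 * #|I|%:Z + (excess on meet_pt)%:Z.
Proof. by rewrite /chern2 (sum_t_E (fun m => m%:Z - 1)) sum_mult_sub1 card_arrangement. Qed.

(** This rests on [3m - 4 = 3(m - 1) - 1]. *)
Lemma chern1sqE :
  chern1sq A = 9 - 5 * #|I|%:Z + 3 * (excess on meet_pt)%:Z - (size (verts meet_pt))%:Z.
Proof.
rewrite /chern1sq (sum_t_E (fun m => 3 * m%:Z - 4)) card_arrangement -[RHS]addrA; congr (_ + _).
rewrite -sum_mult_sub1 mulr_sumr -sum1_size (big_morph Posz PoszD erefl) -sumrB.
by apply: eq_bigr => P _; lia.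
Qed.

End Arrangement.

(** * Generic coordinates and Melchior's inequality in the projective plane *)

Lemma exists_nonroot (R : numFieldType) (J : finType) (D : pred J) (p : J -> {poly R}) :
  (forall j, D j -> p j != 0) -> exists t, forall j, D j -> (p j).[t] != 0.
Proof.
move=> p0; pose q := \prod_(j | D j) p j.
have q0 : q != 0 by apply/prodf_neq0.
pose rs : seq R := [seq i%:R | i <- iota 0 (size q)].
have : ~~ all (root q) rs.
  apply: contraTN isT => hall; have := max_poly_roots q0 hall.
  rewrite size_map size_iota ltnn map_inj_uniq ?iota_uniq; first by move/(_ isT).
  exact: mulrIn (oner_neq0 _).
move=> /allPn[t _]; rewrite /root horner_prod => /prodf_neq0 h.
by exists t.
Qed.

Section MelchiorArrangement.
Variables (R : realFieldType) (I : finType) (ell : I -> set (proj_plane R)).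
Hypothesis ell_line : forall i, is_line (ell i).
Hypothesis ell_inj : injective ell.
Hypothesis no_pencil : forall P, exists i, ~~ on ell i P.

(** The line at infinity is chosen to contain no vertex, and the vertical direction to lie on no
    line; all lines are then graphs with distinct slopes. *)
Lemma melchior : (excess (on ell) (meet_pt ell) <= 2 * size (verts (meet_pt ell)))%N.
Proof.
have /choice[a aP] : forall i, exists a, a != 0 /\ ell i = line_of a.
  by move=> i; have [b b0 eb] := ell_line i; exists b.
have /choice[rep repP] : forall P : proj_plane R, exists u, exists u0 : u != 0, P = mkpt u0.
  by move=> P; have [u [u0 e]] := mkpt_surj P; exists u, u0.
pose al i := crd (a i) 0; pose be i := crd (a i) 1; pose ga i := crd (a i) 2.
(* No line contains the whole conic of points [(1, t, t^2)], so some point of it avoids the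
   arrangement. *)
have [|t ht] := @exists_nonroot R I xpredT (fun i => Poly [:: al i; be i; ga i]).
  move=> i _; have [ai _] := aP i; have [j j3 aj] := crd_neq0 ai.
  apply: contraNneq aj => /(congr1 (fun p : {poly R} => p`_j)); rewrite coef_Poly coef0.
  by case: j j3 => [|[|[|]]] // _ h; apply/eqP; exact: h.
pose o i := al i + be i * t + ga i * t ^+ 2.
have o0 i : o i != 0.
  have := ht i isT; rewrite horner_Poly /= mul0r add0r /o; congr (_ != _); ring.
have cross0 i j : i != j -> cross (a i) (a j) != 0.
  by move=> nij; have [ai ei] := aP i; have [aj ej] := aP j; exact: (cross_ell_neq0 ell_inj nij).
(* The line through [(1, t, t^2)] and [(0, 1, r)] must miss every intersection. For each pair this
   is a condition of degree at most 1 in [r]; if it failed identically, the two normals would be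
   proportional. *)
have [|r hr] := @exists_nonroot R (I * I)%type (fun ij => ij.1 != ij.2)
  (fun ij => Poly [:: be ij.1 * o ij.2 - be ij.2 * o ij.1; ga ij.1 * o ij.2 - ga ij.2 * o ij.1]).
  case=> i j nij; apply: contraNneq (cross0 i j nij) => p0; apply/eqP.
  have {}p0 : Poly [:: be i * o j - be j * o i; ga i * o j - ga j * o i] = 0 := p0.
  move: (p0) => /(congr1 (fun p : {poly R} => p`_0)) /eqP; rewrite coef_Poly coef0 subr_eq0 => /eqP h0.
  move: (p0) => /(congr1 (fun p : {poly R} => p`_1)) /eqP; rewrite coef_Poly coef0 subr_eq0 => /eqP h1.
  have h2 : al i * o j = al j * o i.
    have -> : al i = o i - be i * t - ga i * t ^+ 2 by rewrite /o; ring.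
    have -> : al j = o j - be j * t - ga j * t ^+ 2 by rewrite /o; ring.
    rewrite !mulrBl (mulrAC (be i)) (mulrAC (ga i)) h0 h1; ring.
  have hk x y x' y' : x * o j = x' * o i -> y * o j = y' * o i -> x * y' - y * x' = 0.
    move=> hx hy; apply: (mulfI (o0 i)); rewrite mulr0.
    have -> : o i * (x * y' - y * x') = x * (y' * o i) - y * (x' * o i) by ring.
    by rewrite -hx -hy; ring.
  by apply: crd_inj; rewrite !crd_vec3 crd0; apply: hk.
pose be' i := be i + r * ga i.
have det0 i j : i != j -> be' i * o j != be' j * o i.
  move=> nij; have := hr (i, j) nij; rewrite horner_Poly /= mul0r add0r.
  by apply: contra => /eqP h; apply/eqP; move: h; rewrite /be'; lra.
(* [Y], [X], [Z] are the coordinates in the basis (1, t, t^2), (0, 1, r), (0, 0, 1). *)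
pose Y P := crd (rep P) 0; pose X P := crd (rep P) 1 - t * Y P.
pose Z P := crd (rep P) 2 - t ^+ 2 * Y P - r * X P.
have onP i P : on ell i P = (Y P * o i + X P * be' i + Z P * ga i == 0).
  have [u0 eP] := repP P; have [_ ei] := aP i.
  rewrite {1}eP (onE u0 ei) dotE; congr (_ == _).
  by rewrite /Z /X /Y /be' /o /al /be /ga; ring.
(* At [Z = 0] the equations of two lines through [P] have nonzero determinant in [X] and [Y], which
   would make [rep P] zero. *)
have Z0 P : P \in verts (meet_pt ell) -> Z P != 0.
  rewrite (mem_verts (meet_ptP ell_line ell_inj)) => /card_gt1P[i [j []]].
  rewrite !finset.in_set !onP => /eqP hi /eqP hj nij; apply: contraNneq (det0 i j nij) => ZP.
  have [u0 _] := repP P; move: hi hj; rewrite ZP !mul0r !addr0 => hi hj.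
  apply: contrapT => /negP D; move/eqP: u0; apply.
  have X0 : X P = 0.
    apply/eqP; move: D; apply: contraR => X0; apply/eqP; apply: (mulfI X0).
    by rewrite !mulrA; move: (canRL (addKr _) hi) (canRL (addKr _) hj); rewrite !addr0 => -> ->; ring.
  have Y0 : Y P = 0.
    by apply/eqP; move/eqP: hi; rewrite X0 mul0r addr0 mulf_eq0 (negbTE (o0 i)) orbF.
  apply: crd_inj; rewrite crd0; first exact: Y0.
    by move: X0; rewrite /X Y0 mulr0 subr0.
  by move: ZP; rewrite /Z Y0 X0 !mulr0 !subr0.
apply: (@excess_le_melchior R I _ (on ell) (meet_pt ell) (meet_ptP ell_line ell_inj)
  (fun i => - be' i / o i) (fun i => - ga i / o i) (fun P => X P / Z P) (fun P => Y P / Z P)) => //.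
- move=> i j h; apply: contrapT => /eqP nij; move/eqP: (det0 i j nij); apply.
  move: h; rewrite !mulNr => /oppr_inj h.
  by move/eqP: h; rewrite eqr_div ?o0 // => /eqP ->.
- move=> i P /Z0 ZP; rewrite onP.
  have -> : Y P * o i + X P * be' i + Z P * ga i
     = (Y P / Z P - (- be' i / o i * (X P / Z P) + - ga i / o i)) * (o i * Z P).
    by field; rewrite ZP o0.
  by rewrite mulf_eq0 (mulf_eq0 (o i)) (negbTE (o0 i)) (negbTE ZP) !orbF subr_eq0.
Qed.
End MelchiorArrangement.

(** * Bounds on the Chern numbers *)

Definition admissible (k : fieldType) (A : {fset set (proj_plane k)}) :=
  [/\ line_arrangement A, t_ A #|` A| = 0%N & t_ A #|` A|.-1 = 0%N].

(** [K] is the excess, [v] the number of vertices and [r] the largest multiplicity. The condition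
    [t_d = 0] rules out a pencil, as Melchior's inequality requires; with [t_{d-1} = 0] it gives
    [r <= d - 2]. *)
Lemma admissible_bounds (R : realFieldType) (A : {fset set (proj_plane R)}) :
  admissible A -> exists K v r : nat, let d := #|` A| in
  [/\ chern1sq A = 9 - 5 * d%:Z + 3 * K%:Z - v%:Z,
      chern2 A = 3 - 2 * d%:Z + K%:Z,
      (v + (r - 2) <= K <= 2 * v)%N,
      (r.-1 + r * (d - r) <= K)%N /\ (d * d.-1 <= r * K)%N &
      (K <= d * d.-1)%N /\ (2 <= r <= d - 2)%N].
Proof.
move=> [[d2 hA] td td1].
pose ell (i : A) := val i.
have ell_line i : is_line (ell i) by apply: hA; exact: valP.
have ell_inj : injective ell by exact: val_inj.
have eA : [fset ell i | i in {: A}]%fset = A.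
  apply/fsetP => L; apply/imfsetP/idP => [[i _ ->]|hL]; first exact: valP.
  by exists [` hL]%fset.
have ptP := meet_ptP ell_line ell_inj.
have cI : #|{: A}| = #|` A| by rewrite cardfE.
have tE := t_E ell_line ell_inj; rewrite eA in tE.
have no_mult m P : (1 < m)%N -> t_ A m = 0%N -> mult (on ell) P != m.
  move=> m1; rewrite tE // => c0; apply/eqP => Pm.
  have PV : P \in verts (meet_pt ell) by rewrite (mem_verts ptP) Pm.
  move: c0; apply/eqP; rewrite -lt0n -has_count; apply/hasP.
  by exists P; rewrite // Pm.
have no_pencil P : exists i, ~~ on ell i P.
  apply: contrapT => h; have /eqP := no_mult _ P d2 td; apply.
  rewrite /mult -cI; apply/eqP; rewrite eqn_leq max_card subset_leq_card //.
  apply/fintype.subsetP => i _; rewrite finset.in_set; apply: contrapT => hi; apply: h.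
  by exists i; apply/negP.
have [p1 p1V] : exists p, p \in verts (meet_pt ell).
  have /card_gt1P[i [j [_ _ nij]]] : (1 < #|{: A}|)%N by rewrite cI.
  by exists (meet_pt ell i j); exact: (pt_verts ptP).
pose Q m := has (fun p => mult (on ell) p == m) (verts (meet_pt ell)).
have exQ : exists m, Q m by exists (mult (on ell) p1); apply/hasP; exists p1.
have ubQ m : Q m -> (m <= #|` A|)%N by move=> /hasP[p _ /eqP<-]; rewrite -cI max_card.
case: (ex_maxnP exQ ubQ) => r /hasP[p0 p0V /eqP mp0] rmax.
exists (excess (on ell) (meet_pt ell)), (size (verts (meet_pt ell))), r.
have c1 := chern1sqE ell_line ell_inj; have c2 := chern2E ell_line ell_inj.
rewrite eA cI in c1 c2.
have r2 : (1 < r)%N by rewrite -mp0 -(mem_verts ptP).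
have rd : (r <= #|` A|)%N by rewrite -mp0 -cI max_card.
have rnd : r != #|` A| by rewrite -mp0 no_mult.
have rnd1 : r != #|` A|.-1 by rewrite -mp0 no_mult //; lia.
have e1 := excess_pencil ptP p0V; have := pencil_card (on ell) p0; rewrite cI mp0 in e1 * => es.
split=> //.
- rewrite -mp0 (size_verts_le ptP p0V) /=; exact: melchior.
- split; last first.
    rewrite -cI; apply: (excess_ge_max ptP) => p pV; apply: rmax; apply/hasP.
    by exists p.
  by rewrite -es addKn.
- by rewrite -cI (excess_le ptP) cI; split => //; lia.
Qed.

Section Bounds.
Variables (R : realFieldType) (A : {fset set (proj_plane R)}).
Hypothesis hA : admissible A.
Let d := #|` A|.

(** For [r >= 3], [c_2 >= (r - 2)(d - r - 1)] with both factors positive; for [r = 2],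
    [2K >= d(d - 1)] suffices. *)
Lemma chern2_ge : 0 < chern2 A /\ d%:Z - 4 <= chern2 A.
Proof.
have [K [v [r [_ -> _ [h1 h2] [_ h3]]]]] := admissible_bounds hA; rewrite -/d in h1 h2 h3 *.
have [r3|r3] := leqP 3 r.
  pose s := (d - r)%N; have ds : d = (r + s)%N by rewrite /s; lia.
  rewrite -/s in h1; split; nia.
have r2 : r = 2%N by lia.
subst r; split; nia.
Qed.

Lemma chern1sq_le : 2 * chern1sq A <= 5 * chern2 A + 3.
Proof.
have [K [v [r [-> -> h _ _]]]] := admissible_bounds hA; lia.
Qed.

(** The difference is at most [s - 1] with [s = d - r]. If [r >= N + 2], then
    [c_2 >= (r - 2)(s - 1)] suffices; otherwise [K >= d(d - 1)/r] exceeds [(N + 2) d], so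
    [c_2 > N d]. *)
Lemma chern1sq_ge N : ((N + 2) ^ 2 < d)%N -> N%:Z * (2 * chern2 A - chern1sq A) <= chern2 A.
Proof.
have [K [v [r [-> -> h0 [h1 h2] [_ h3]]]]] := admissible_bounds hA; rewrite -/d in h1 h2 h3 *.
move=> hd; pose s := (d - r)%N; have ds : d = (r + s)%N by rewrite /s; lia.
rewrite -/s in h1.
have key : 2 * (3 - 2 * d%:Z + K%:Z) - (9 - 5 * d%:Z + 3 * K%:Z - v%:Z) <= s%:Z - 1 by lia.
apply: le_trans (ler_wpM2l _ key) _ => //.
have [rN|rN] := leqP (N + 2) r; first by nia.
nia.
Qed.

Lemma chern_bounded D : (d <= D)%N ->
  (`|chern1sq A| <= 20 * D ^ 2)%N /\ (`|chern2 A| <= 20 * D ^ 2)%N.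
Proof.
have [K [v [r [-> -> h0 _ [h1 h3]]]]] := admissible_bounds hA; rewrite -/d in h1 h3 *.
move=> dD; have : (K <= D ^ 2)%N by apply: leq_trans h1 _; rewrite -mulnn leq_mul // ; lia.
have : (D <= D ^ 2)%N by rewrite -mulnn; nia.
lia.
Qed.
End Bounds.

(** * Limit points *)

Section LimitPoints.
Variable R : realType.

(** Both Chern numbers are integers in a range that depends only on [D]. *)
Lemma finite_slopes D : finite_set
  [set chern_slope R A | A in [set A : {fset set (proj_plane R)} |
    admissible A /\ (#|` A| <= D)%N]].
Proof.
pose B := (20 * D ^ 2)%N.
pose ints := [seq i%:Z | i <- iota 0 B.+1] ++ [seq - i%:Z | i <- iota 0 B.+1].
have inB (z : int) : (`|z| <= B)%N -> z \in ints.
  rewrite mem_cat -ltnS => zB; case: (intP z) zB => [|n|n] h.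
  - by apply/orP; left; apply/mapP; exists 0%N; rewrite // mem_iota.
  - by apply/orP; left; apply/mapP; exists n.+1; rewrite // mem_iota.
  - by apply/orP; right; apply/mapP; exists n.+1; rewrite // mem_iota; lia.
apply: (@sub_finite_set _ _ [set` [seq (p%:~R / q%:~R : R) | p <- ints, q <- ints]]).
  move=> _ [A [hA AD] <-]; have [h1 h2] := chern_bounded hA AD.
  by apply/allpairsP; exists (chern1sq A, chern2 A); rewrite /= !inB.
exact: finite_seq.
Qed.

(** A limit point survives the removal of the finitely many slopes coming from at most [D] lines. *)
Lemma limit_point_slopes (x e : R) D : limit_point (chern_slopes R R) x -> 0 < e ->
  exists A : {fset set (proj_plane R)},
    [/\ admissible A, (D < #|` A|)%N & `|x - chern_slope R A| < e].
Proof.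
move=> lx e0.
have [y [_ [[A [A1 A2 A3 ey]] yF] ye]] :=
  limit_point_setD (finite_slopes D) lx (nbhsx_ballx x e e0).
exists A; rewrite -ey; split => //; rewrite ltnNge; apply/negP => AD; apply: yF.
by exists A.
Qed.

Lemma limit_point_sub : limit_point (chern_slopes R R) `<=` `[2%:R, 5%:R / 2%:R]%classic.
Proof.
move=> x lx; rewrite /= in_itv /=; apply/andP; split; rewrite leNgt; apply/negP => hx.
  (* A slope within [e] of [x] is below [2 - e], so [e c_2 < 2 c_2 - c_1^2 <= c_2 / N], against
     [e N > 1]. *)
  pose e := (2 - x) / 2; have e0 : 0 < e by rewrite /e; lra.
  pose N := (Num.truncn e^-1).+1.
  have eN : 1 < e * N%:R.
    by rewrite mulrC -ltr_pdivrMr // mul1r truncnS_gt.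
  have [A [hA dA]] := limit_point_slopes ((N + 2) ^ 2)%N lx e0.
  have [c0 _] := chern2_ge hA; have := chern1sq_ge hA dA.
  rewrite -(ler_int R) !intrM !intrB !intrM => h.
  have b0 : 0 < (chern2 A)%:~R :> R by rewrite ltr0z.
  rewrite ltr_distl => /andP[h' _].
  have : chern_slope R A < 2 - e by move: h'; rewrite /e; lra.
  rewrite /chern_slope ltr_pdivrMr // => h''.
  have N0 : 0 < N%:R :> R by rewrite ltr0n.
  have h3 : e * (chern2 A)%:~R < 2 * (chern2 A)%:~R - (chern1sq A)%:~R by lra.
  have : N%:R * (e * (chern2 A)%:~R) < (chern2 A)%:~R.
    by apply: lt_le_trans h; rewrite ltr_pM2l.
  rewrite mulrA (mulrC _ e) gtr_pMl //; lra.
pose e := (x - 5 / 2) / 2; have e0 : 0 < e by rewrite /e; lra.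
pose N := (Num.truncn e^-1).+1.
have eN : 1 < e * N%:R.
  by rewrite mulrC -ltr_pdivrMr // mul1r truncnS_gt.
(* This many lines force [c_2 >= 2N], so [e c_2 > 2] outweighs the constant in
   [c_1^2 <= (5 c_2 + 3)/2]. *)
have [A [hA dA]] := limit_point_slopes (2 * N + 4)%N lx e0.
have [c0 cd] := chern2_ge hA; have := chern1sq_le hA.
rewrite -(ler_int R) intrD !intrM => h.
have cN : (2 * N)%N%:Z <= chern2 A.
  by apply: le_trans cd; rewrite lerBrDr -[4]/(4%:Z) -PoszD lez_nat; exact: ltnW dA.
move: cN; rewrite -(ler_int R) -pmulrn natrM => cN.
have b0 : 0 < (chern2 A)%:~R :> R by rewrite ltr0z.
rewrite ltr_distl => /andP[_ h'].
have : 5 / 2 + e < chern_slope R A by move: h'; rewrite /e; lra.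
rewrite /chern_slope ltr_pdivlMr // => h''.
have : e * (2 * N%:R) <= e * (chern2 A)%:~R by rewrite ler_pM2l.
lra.
Qed.
End LimitPoints.

(** * A pencil with tangents of a circle *)

Section PencilTangents.
Variables (R : realType) (n s : nat).
Hypotheses (n3 : (2 < n)%N) (s2 : (1 < s)%N) (sn : (s <= n)%N).
Let I : finType := ('I_n + 'I_s)%type.

Definition angle (j : nat) : R := j%:R * pi / n%:R.

(** [inl m] is the axis in direction [angle m]; [inr j] is the tangent to the unit circle at
    argument [2 * angle j], so the points of contact are among the vertices of a regular [n]-gon. *)
Definition normal (i : I) : 'rV[R]_3 := match i with
  | inl m => vec3 (sin (angle m)) (- cos (angle m)) 0
  | inr j => vec3 (cos (angle j + angle j)) (sin (angle j + angle j)) (-1)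
  end.

Definition pencil_line i := line_of (normal i).

(** The intersection of tangents [j] and [k], at infinity when their points of contact are opposite;
    for [j = k] the point of contact. *)
Definition tangent_pt (j k : nat) : 'rV[R]_3 :=
  vec3 (cos (angle j + angle k)) (sin (angle j + angle k)) (cos (angle j - angle k)).

Lemma n_neq0 : n%:R != 0 :> R. Proof. by rewrite pnatr_eq0; lia. Qed.

Lemma sin_angle_neq0 i j : (i < n)%N -> (j < n)%N -> i != j -> sin (angle i - angle j) != 0.
Proof.
have pos a b : (a < b)%N -> (b < n)%N -> 0 < sin (angle b - angle a).
  move=> ab bn; have -> : angle b - angle a = (b - a)%N%:R / n%:R * pi.
    by rewrite /angle (natrB _ (ltnW ab)) -mulrBl -mulrBl mulrAC.
  have n_gt0 : 0 < n%:R :> R by rewrite ltr0n; lia.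
  have c0 : 0 < (b - a)%N%:R / n%:R :> R by rewrite divr_gt0 // ltr0n subn_gt0.
  have c1 : (b - a)%N%:R / n%:R < 1 :> R by rewrite ltr_pdivrMr // mul1r ltr_nat; lia.
  apply: sin_gt0_pi; apply/andP; split; first by apply: mulr_gt0 => //; exact: pi_gt0.
  by rewrite gtr_pMl //; exact: pi_gt0.
move=> hi hj; rewrite neq_ltn => /orP[h|h]; last by rewrite gt_eqF // pos.
by rewrite -opprB sinN oppr_eq0 gt_eqF // pos.
Qed.

(** From [cos(x + y) - cos(x - y) = -2 sin x sin y]. The factors vanish only for [i = j] or [i = k],
    hence no three tangents concur. *)
Lemma dot_tangent i j k :
  dot (vec3 (cos (angle i + angle i)) (sin (angle i + angle i)) (-1)) (tangent_pt j k) =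
  -2 * sin (angle i - angle k) * sin (angle i - angle j).
Proof.
rewrite dotE !crd_vec3.
have -> : cos (angle i + angle i) * cos (angle j + angle k) + sin (angle i + angle i) * sin (angle j + angle k)
   = cos ((angle i - angle k) + (angle i - angle j)) by rewrite -cosB; congr cos; ring.
have -> : angle j - angle k = (angle i - angle k) - (angle i - angle j) by ring.
set x := angle i - angle k; set y := angle i - angle j.
by rewrite cosD (cosB x y); ring.
Qed.

Lemma dot_axis m j k :
  dot (vec3 (sin (angle m)) (- cos (angle m)) 0) (tangent_pt j k) = sin (angle m - (angle j + angle k)).
Proof. by rewrite dotE !crd_vec3 sinB; ring. Qed.

Lemma circle_neq0 (x z : R) : vec3 (cos x) (sin x) z != 0 :> 'rV[R]_3.
Proof.
apply/eqP => h; have := cos2Dsin2 x.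
have := congr1 (fun v => crd v 0) h; have := congr1 (fun v => crd v 1) h.
rewrite /= !crd_vec3 !crd0 => -> -> /eqP.
by rewrite expr0n /= addr0 eq_sym oner_eq0.
Qed.

Lemma center_neq0 : vec3 0 0 1 != 0 :> 'rV[R]_3.
Proof.
by apply/eqP => /(congr1 (fun v => crd v 2)) /eqP; rewrite crd_vec3 crd0 oner_eq0.
Qed.

Definition pencil_center_pt : proj_plane R := mkpt center_neq0.

Lemma pencil_line_is_line i : is_line (pencil_line i).
Proof.
exists (normal i) => //; case: i => [m|j]; last exact: circle_neq0.
apply/eqP => h; have := cos2Dsin2 (angle m).
have := congr1 (fun v => crd v 0) h; have := congr1 (fun v => crd v 1) h.
rewrite /= !crd_vec3 !crd0 => /eqP; rewrite oppr_eq0 => /eqP -> -> /eqP.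
by rewrite expr0n /= addr0 eq_sym oner_eq0.
Qed.

Lemma on_pencil_center i : on pencil_line i pencil_center_pt = if i is inl _ then true else false.
Proof.
rewrite /pencil_center_pt (@onE R I pencil_line (normal i)) //; case: i => [m|j];
  rewrite dotE !crd_vec3 ?mulr0 ?mul0r !add0r ?eqxx //.
by rewrite mulr1 oppr_eq0 oner_eq0.
Qed.

Lemma pencil_line_inj : injective pencil_line.
Proof.
move=> i j e; have eon P : on pencil_line i P = on pencil_line j P by rewrite /on e.
have := eon pencil_center_pt; rewrite !on_pencil_center.
case: i e eon => [i|i] e eon; case: j e eon => [j|j] // e eon _; congr (_ _).
  (* Axes are told apart by their points at infinity. *)
  have := eon (mkpt (circle_neq0 (angle i) 0)).
  rewrite (@onE R I pencil_line (normal (inl i))) // (@onE R I pencil_line (normal (inl j))) //.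
  rewrite !dotE !crd_vec3 !mulr0 !addr0 !mulNr -!sinB subrr sin0 eqxx => /esym h.
  by apply: val_inj; apply/eqP; apply: contraTT h => ij; rewrite sin_angle_neq0 // eq_sym.
(* Tangents are told apart by their points of contact. *)
have := eon (mkpt (circle_neq0 (angle i + angle i) (cos (angle i - angle i)))).
rewrite (@onE R I pencil_line (normal (inr i))) // (@onE R I pencil_line (normal (inr j))) //.
rewrite !dot_tangent subrr sin0 !mulr0 eqxx => /esym h.
apply: val_inj; apply/eqP; apply: contraTT h => ij.
have hs : sin (angle j - angle i) != 0 by rewrite sin_angle_neq0 // ?(leq_trans (ltn_ord _) sn) // eq_sym.
by rewrite !mulf_neq0 // oppr_eq0 pnatr_eq0.
Qed.

Definition pencil_ptP := meet_ptP pencil_line_is_line pencil_line_inj.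

Lemma on_two_tangents (j k : 'I_s) P : j != k -> on pencil_line (inr j) P -> on pencil_line (inr k) P ->
  P = mkpt (circle_neq0 (angle j + angle k) (cos (angle j - angle k))).
Proof.
move=> njk hj hk; have njk' : inr j != inr k :> I by [].
have e Q : on pencil_line (inr j) Q -> on pencil_line (inr k) Q -> Q = meet_pt pencil_line (inr j) (inr k).
  by move=> qj qk; apply/eqP; rewrite -pencil_ptP // qj.
rewrite (e _ hj hk); apply/esym/e.
  by rewrite (@onE R I pencil_line (normal (inr j))) // dot_tangent subrr sin0 mulr0.
by rewrite (@onE R I pencil_line (normal (inr k))) // dot_tangent subrr sin0 mulr0 mul0r.
Qed.

(** Since [j + k < 2n], reduction modulo [n] changes the angle by 0 or [pi], which gives the same
    axis. *)
Lemma on_axis_sum (j k : 'I_s) (m : 'I_n) P : j != k ->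
  on pencil_line (inr j) P -> on pencil_line (inr k) P -> val m = ((j + k) %% n)%N ->
  on pencil_line (inl m) P.
Proof.
move=> njk hj hk em; rewrite (on_two_tangents njk hj hk).
rewrite (@onE R I pencil_line (normal (inl m))) // dot_axis.
pose q := ((j + k) %/ n)%N.
have ej : (j + k = q * n + m)%N by rewrite em -divn_eq.
have e : angle j + angle k = (q%:R * n%:R + m%:R) * pi / n%:R.
  by rewrite /angle -mulrDl -mulrDl -natrD ej natrD natrM.
have -> : angle m - (angle j + angle k) = - (q%:R * pi).
  rewrite e /angle mulrDl mulrDl opprD addrCA subrr addr0.
  by rewrite (mulrAC _ n%:R) mulfK ?n_neq0.
have : (q < 2)%N by rewrite ltn_divLR; have := ltn_ord j; have := ltn_ord k; lia.
rewrite sinN oppr_eq0; case: q {ej e} => [|[|//]] _.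
  by rewrite mul0r sin0.
by rewrite mul1r sinpi.
Qed.

Lemma tangents_not_concurrent (i j k : 'I_s) P : i != j -> i != k -> j != k ->
  ~ [/\ on pencil_line (inr i) P, on pencil_line (inr j) P & on pencil_line (inr k) P].
Proof.
move=> nij nik njk [hi hj hk]; move: hi; rewrite (on_two_tangents njk hj hk).
rewrite (@onE R I pencil_line (normal (inr i))) // dot_tangent.
have lt (a : 'I_s) : (a < n)%N by exact: leq_trans (ltn_ord a) sn.
by rewrite !mulf_eq0 !(negbTE (sin_angle_neq0 _ _ _)) // oppr_eq0 pnatr_eq0.
Qed.

Lemma mult_center : mult (on pencil_line) pencil_center_pt = n.
Proof.
rewrite /mult -[RHS](card_ord n) -(card_imset predT (@inl_inj 'I_n 'I_s)).
apply: eq_card => -[m|j]; rewrite finset.in_set on_pencil_center.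
  by apply/esym/imsetP; exists m.
by apply/esym/negbTE/imsetP => -[].
Qed.

Lemma center_verts : pencil_center_pt \in verts (meet_pt pencil_line).
Proof. by rewrite (mem_verts pencil_ptP) mult_center; lia. Qed.

Lemma verts_on_axes q : q \in verts (meet_pt pencil_line) -> q != pencil_center_pt ->
  #|[set i | on pencil_line i pencil_center_pt && on pencil_line i q]%SET| = 1%N /\
  (#|[set i | ~~ on pencil_line i pencil_center_pt && on pencil_line i q]%SET| <= 2)%N.
Proof.
move=> qV qc; split; last first.
  rewrite leqNgt; apply/negP => /card_gt2P[x [y [z [[]]]]].
  rewrite !finset.in_set !on_pencil_center.
  case: x => [//|x] /= hx; case: y => [//|y] /= hy; case: z => [//|z] /= hz [nxy nyz nzx].
  have neq (a b : 'I_s) : inr a != inr b :> I -> a != b by apply: contra => /eqP->.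
  have nxz : x != z by rewrite eq_sym; exact: neq.
  exact: (tangents_not_concurrent (neq _ _ nxy) nxz (neq _ _ nyz) (And3 hx hy hz)).
apply/eqP; rewrite eqn_leq (pencil_le1 pencil_ptP qc) /=; apply/card_gt0P.
suff [m hm] : exists m, on pencil_line (inl m) q.
  by exists (inl m); rewrite finset.in_set on_pencil_center hm.
move: qV; rewrite (mem_verts pencil_ptP) => /card_gt1P[x [y []]]; rewrite !finset.in_set.
case: x => [m|x]; first by move=> h _ _; exists m.
case: y => [m|y]; first by move=> _ h _; exists m.
move=> hx hy nxy; have nxy' : x != y by apply: contra nxy => /eqP->.
have mn : ((x + y) %% n < n)%N by rewrite ltn_mod; lia.
by exists (Ordinal mn); exact: (on_axis_sum nxy' hx hy).
Qed.

Lemma pencil_slope :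
  chern_slopes R R (2 + (s - 2)%N%:R / (2 * (n - 2)%N%:R)).
Proof.
pose A := [fset pencil_line i | i in I]%fset.
have cI : #|{: I}| = (n + s)%N by rewrite card_sum !card_ord.
have cA : #|` A| = (n + s)%N by rewrite (card_arrangement pencil_line_inj) cI.
have tE := t_E pencil_line_is_line pencil_line_inj; rewrite -/A in tE.
have cs : #|[set i | ~~ on pencil_line i pencil_center_pt]%SET| = s.
  by have := pencil_card (on pencil_line) pencil_center_pt; rewrite mult_center cI => /addnI.
(* The center has multiplicity [n] and every other vertex at most 3; [d - 1 = n + s - 1] exceeds
   both. *)
have t0 m : (n < m)%N -> (3 < m)%N -> t_ A m = 0%N.
  move=> nm m3; rewrite tE; last lia.
  apply/eqP; rewrite -leqn0 leqNgt -has_count; apply/hasPn => q qV.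
  have [->|qc] := eqVneq q pencil_center_pt; first by rewrite mult_center; lia.
  have [e1 e2] := verts_on_axes qV qc.
  by rewrite (mult_pencil _ pencil_center_pt) e1; lia.
exists A; split.
- split; first by rewrite cA; lia.
  by move=> L /imfsetP[i _ ->]; exact: pencil_line_is_line.
- by rewrite cA t0; lia.
- by rewrite cA t0; lia.
have c1 := chern1sqE pencil_line_is_line pencil_line_inj.
have c2 := chern2E pencil_line_is_line pencil_line_inj.
have k1 := excess_pencil_eq pencil_ptP center_verts verts_on_axes.
have k2 := size_verts_pencil pencil_ptP center_verts verts_on_axes.
rewrite -/A cI in c1 c2; rewrite mult_center cs in k1 k2.
have h2 : chern2 A = ((n - 2) * (s - 1))%N%:Z by rewrite c2 k1; nia.
(* Doubling clears the half in the term [s(s - 1)/2] of the vertex count. *)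
have h1 : 2 * chern1sq A = ((s - 1) * (4 * (n - 2) + (s - 2)))%N%:Z.
  have ez2 : (n - 2)%N%:Z = n%:Z - 2 by lia.
  have es1 : (s - 1)%N%:Z = s%:Z - 1 by lia.
  have es2 : (s - 2)%N%:Z = s%:Z - 2 by lia.
  have k1z : (excess (on pencil_line) (meet_pt pencil_line))%:Z = n%:Z - 1 + n%:Z * s%:Z.
    by rewrite k1 PoszD PoszM; lia.
  have k2z : (size (verts (meet_pt pencil_line)))%:Z * 2
      = 2 * (n%:Z - 1 + n%:Z * s%:Z) - 2 * (n%:Z - 2) - s%:Z * (s%:Z - 1).
    by rewrite -k1z; nia.
  by rewrite c1 k1z; nia.
have h1' : 2 * (chern1sq A)%:~R = ((s - 1) * (4 * (n - 2) + (s - 2)))%N%:R :> R.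
  by rewrite -[2]/(2%:~R) -intrM h1 -pmulrn.
have a0 : (n - 2)%N%:R != 0 :> R by rewrite pnatr_eq0; lia.
have b0 : (s - 1)%N%:R != 0 :> R by rewrite pnatr_eq0; lia.
rewrite /chern_slope h2 -pmulrn; move: h1'; rewrite !natrM natrD natrM => h1'.
have -> : (chern1sq A)%:~R = (s - 1)%N%:R * (4 * (n - 2)%N%:R + (s - 2)%N%:R) / 2 :> R.
  by rewrite -h1'; field.
by field; rewrite a0 b0.
Qed.

End PencilTangents.

(** * Density of the slopes in the interval *)

Lemma limit_point_sup (R : realType) :
  `[2%:R, 5%:R / 2%:R]%classic `<=` limit_point (chern_slopes R R).
Proof.
have slopes p q : (p <= q)%N -> (0 < q)%N ->
    chern_slopes R R (2 + p%:R / (2 * q%:R)).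
  move=> pq q0; have := @pencil_slope R q.+2 p.+2.
  by rewrite !subSS !subn0; apply; rewrite !ltnS.
move=> x; rewrite /= in_itv /= => /andP[x2 x5] U /nbhs_ballP[e /= e0 eU].
have [xlt|xge] := ltP x (5 / 2).
  (* The slope chosen is the first [2 + p/(2q)] strictly above [x], with [1/q < d]. The bound
     [d <= 5/2 - x] keeps it below [5/2], so that [p <= q]. *)
  pose d := Num.min e (5 / 2 - x).
  have d0 : 0 < d by rewrite lt_min e0 subr_gt0.
  pose q := (Num.truncn d^-1).+1.
  have dq : 1 < d * q%:R by rewrite mulrC -ltr_pdivrMr // mul1r truncnS_gt.
  pose z := 2 * q%:R * (x - 2); have z0 : 0 <= z by rewrite !mulr_ge0 // subr_ge0.
  pose p := (Num.truncn z).+1.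
  have zp : z < p%:R := truncnS_gt z.
  have pz : p%:R <= z + 1 by rewrite -natr1 lerD2r truncn_le.
  have q0 : 0 < q%:R :> R by rewrite ltr0n.
  have hx : x = 2 + z / (2 * q%:R) by rewrite /z; field; rewrite gt_eqF.
  have xy : x < 2 + p%:R / (2 * q%:R).
    by rewrite {1}hx ltrD2l ltr_pM2r // invr_gt0 mulr_gt0.
  have yx : 2 + p%:R / (2 * q%:R) < x + d.
    have -> : 2 + p%:R / (2 * q%:R) = x + (p%:R - z) / (2 * q%:R).
      by rewrite {1}hx; field; rewrite gt_eqF.
    by rewrite ltrD2l ltr_pdivrMr ?mulr_gt0 //; lra.
  exists (2 + p%:R / (2 * q%:R)); split; first by rewrite gt_eqF.
    apply: slopes => //.
    have : 2 + p%:R / (2 * q%:R) < 2 + 1 / 2 :> R.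
      by apply: (lt_le_trans yx); have : d <= 5 / 2 - x by [rewrite ge_min lexx orbT]; lra.
    rewrite ltrD2l ltr_pdivrMr ?mulr_gt0 // mul1r mulKf // ltr_nat.
    exact: ltnW.
  apply: eU; rewrite /ball /= ltr_distl ltrBlDr.
  have de : d <= e by rewrite ge_min lexx.
  by apply/andP; split; lra.
have {x2 x5 xge}x52 : x = 5 / 2 by apply/eqP; rewrite eq_le x5.
(* The endpoint is approached from below, by the slopes with [p/q] replaced by [q/(q + 1)]. *)
pose q := Num.truncn e^-1.
have eq1 : 1 < e * q.+1%:R by rewrite mulrC -ltr_pdivrMr // mul1r truncnS_gt.
have q0 : 0 < q.+1%:R :> R by rewrite ltr0n.
have yE : 2 + q%:R / (2 * q.+1%:R) = x - 1 / (2 * q.+1%:R).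
  have -> : q%:R = q.+1%:R - 1 :> R by rewrite -natr1 addrK.
  by rewrite x52; move: (q.+1%:R : R) q0 => z z0; field; rewrite gt_eqF.
have y0 : 0 < 1 / (2 * q.+1%:R) :> R by rewrite divr_gt0 // mulr_gt0.
have ye : 1 / (2 * q.+1%:R) < e by rewrite ltr_pdivrMr ?mulr_gt0 // mulrCA; lra.
exists (2 + q%:R / (2 * q.+1%:R)); split; [|exact: slopes|]; rewrite yE.
  by rewrite lt_eqF // gtrBl.
by apply: eU; rewrite /ball /= opprB addrC subrK gtr0_norm.
Qed.


Theorem corollary4p4 (R : realType) :
  limit_point (chern_slopes R R) = `[2%:R, 5%:R / 2%:R]%classic.
Proof.
by apply/seteqP; split; [exact: limit_point_sub|exact: limit_point_sup].
Qed.
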